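(* Let $K$ be a field, let $(Q,I)$ be a gentle quiver, and let $A=KQ/I$ be the corresponding (finite-dimensional) gentle algebra. For $k\ge 1$ denote by $c_k$ the number of minimal oriented $k$-cycles in $Q$ with full zero relations. Then the $q$-Cartan matrix $C_A(q)$ is unimodularly equivalent over $\mathbb{Z}[q]$ to a diagonal matrix in which, for each $k\geq 1$, the entry $1-(-q)^k$ occurs with multiplicity $c_k$, and all further diagonal entries are $1$.
   Context: A quiver $Q$ is a finite directed graph (loops and multiple arrows allowed) with vertex set $Q_0$; for an arrow $\alpha$, $s(\alpha)$ is its start vertex and $t(\alpha)$ its end vertex. Paths are read from left to right: an oriented path of length $r\ge 1$ is a sequence $\alpha_1\alpha_2\cdots\alpha_r$ of arrows with $t(\alpha_i)=s(\alpha_{i+1})$, and each vertex $v$ has a trivial path $e_v$ of length $0$. The path algebra $KQ$ has all oriented paths as $K$-basis, and multiplication is concatenation (zero if the paths cannot be concatenated). An ideal $I\subset KQ$ is admissible if $I\subseteq J^2$, where $J$ is the ideal generated by the arrows. A pair $(Q,I)$ with $I$ an admissible ideal of $KQ$ is a gentle quiver if: (i) each vertex is the start point of at most two arrows and the end point of at most two arrows; (ii) for each arrow $\alpha$ there is at most one arrow $\beta$ with $\alpha\beta\notin I$ and at most one arrow $\gamma$ with $\gamma\alpha\notin I$; (iii) $I$ is generated by paths of length $2$; (iv) for each arrow $\alpha$ there is at most one arrow $\beta'$ with $t(\alpha)=s(\beta')$ and $\alpha\beta'\in I$, and at most one arrow $\gamma'$ with $t(\gamma')=s(\alpha)$ and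 $\gamma'\alpha\in I$. A finite-dimensional algebra of the form $KQ/I$ with $(Q,I)$ gentle is called a gentle algebra; finite-dimensionality of $KQ/I$ is always assumed. The $q$-Cartan matrix of a finite-dimensional algebra $A=KQ/I$ with $I$ generated by homogeneous relations (linear combinations of paths of the same length) is the $|Q_0|\times|Q_0|$ matrix $C_A(q)=(c_{ij}(q))$ over $\mathbb{Z}[q]$, $q$ an indeterminate, with $c_{ij}(q)=\sum_n \dim_K (e_iAe_j)_n\,q^n$, where $e_iAe_j=\bigoplus_n (e_iAe_j)_n$ is the grading induced by path length. An oriented $k$-cycle with full zero relations ($k\ge1$) is an oriented path $p=p_0p_1\cdots p_{k-1}$ with arrows $p_0,\dots,p_{k-1}$ in $Q$ having the same start and end point and such that $p_ip_{i+1}\in I$ for $i=0,\dots,k-2$ and $p_{k-1}p_0\in I$. It is minimal if $p_0,\dots,p_{k-1}$ are pairwise different arrows. Such cycles are counted up to cyclic rotation (choice of starting point). Two square matrices $C,D$ over $\mathbb{Z}[q]$ are unimodularly equivalent (over $\mathbb{Z}[q]$) if there are matrices $P,P'$ over $\mathbb{Z}[q]$ of determinant $1$ with $D=PCP'$. *)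

(* Defs.v *)
From HB Require Import structures.
From mathcomp Require Import all_boot all_order all_algebra.
From mathcomp Require Import finmap.
From mathcomp Require Import boolp classical_sets fsbigop.
From mathcomp.multinomials Require Import monalg.

Set Implicit Arguments.
Unset Strict Implicit.
Unset Printing Implicit Defensive.

Import GRing.Theory.
Local Open Scope classical_set_scope.
Local Open Scope fset_scope.
Local Open Scope ring_scope.

Record quiver := Quiver {
  vertex : finType;
  arrow : finType;
  source : arrow -> vertex;
  target : arrow -> vertex
}.

Section Paths.
Variable Q : quiver.

Fixpoint walk (v : vertex Q) (s : seq (arrow Q)) : bool :=
  if s is a :: s' then (source a == v) && walk (target a) s' else true.

(* Paths are read from left to right. The start vertex is part of the data
   because the arrow sequence of a trivial path is empty. *)
Definition qpath : Type := {p : vertex Q * seq (arrow Q) | walk p.1 p.2}.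
HB.instance Definition _ := SubChoice.on qpath.

Definition path_start (p : qpath) : vertex Q := (val p).1.
Definition path_arrows (p : qpath) : seq (arrow Q) := (val p).2.
Definition path_end (p : qpath) : vertex Q :=
  last (path_start p) [seq target a | a <- path_arrows p].
Definition path_length (p : qpath) : nat := size (path_arrows p).

Definition trivial_path (v : vertex Q) : qpath :=
  exist (fun p : vertex Q * seq (arrow Q) => walk p.1 p.2) (v, [::]) isT.

Lemma walk1 (a : arrow Q) : walk (source a) [:: a].
Proof. by rewrite /= eqxx. Qed.

Definition arrow_path (a : arrow Q) : qpath :=
  exist (fun p : vertex Q * seq (arrow Q) => walk p.1 p.2)
    (source a, [:: a]) (walk1 a).

Definition concat (p q : qpath) : option qpath :=
  if path_end p == path_start q
  then insub (path_start p, path_arrows p ++ path_arrows q) else None.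

Lemma walk_cat v s1 s2 : walk v (s1 ++ s2) =
  walk v s1 && walk (last v [seq target a | a <- s1]) s2.
Proof. by elim: s1 v => //= a s1 IH v; rewrite IH andbA. Qed.

Lemma concatP p q : path_end p = path_start q ->
  exists2 r, concat p q = Some r
    & val r = (path_start p, path_arrows p ++ path_arrows q).
Proof.
rewrite /concat => /[dup] e ->; rewrite eqxx.
case: insubP => [r _ er|]; first by exists r.
rewrite /= walk_cat (valP p) /=; move: e; rewrite /path_end => ->.
by rewrite (valP q).
Qed.

Lemma concatN p q : path_end p != path_start q -> concat p q = None.
Proof. by rewrite /concat => /negPf->. Qed.

Lemma concat1p p : concat (trivial_path (path_start p)) p = Some p.
Proof.
have [r -> er] := @concatP (trivial_path (path_start p)) p erefl.
by congr Some; apply: val_inj; rewrite er [RHS]surjective_pairing.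
Qed.

Lemma concatp1 p : concat p (trivial_path (path_end p)) = Some p.
Proof.
have [r -> er] := @concatP p (trivial_path (path_end p)) erefl.
by congr Some; apply: val_inj; rewrite er /= cats0 [RHS]surjective_pairing.
Qed.

Lemma concatA p q r :
  obind (concat p) (concat q r) = obind (concat^~ r) (concat p q).
Proof.
have [epq|npq] := eqVneq (path_end p) (path_start q); last first.
  rewrite (concatN npq) /=.
  have [eqr|nqr] := eqVneq (path_end q) (path_start r); last first.
    by rewrite concatN.
  have [s -> es] := concatP eqr; rewrite /= concatN //.
  by rewrite /path_start es.
have [s -> es] := concatP epq.
have end_s : path_end s = path_end q.
  rewrite /path_end /path_start /path_arrows es /= map_cat last_cat.
  by congr last; exact: epq.
have [eqr|nqr] := eqVneq (path_end q) (path_start r); last first.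
  by rewrite concatN //= concatN // end_s.
have [t -> et] := concatP eqr => /=.
have ept : path_end p = path_start t by rewrite epq /path_start et.
have esr : path_end s = path_start r by rewrite end_s.
have [u -> eu] := concatP ept; have [w -> ew] := concatP esr.
congr Some; apply: val_inj; rewrite eu ew.
by rewrite /path_start /path_arrows es et /= catA.
Qed.

End Paths.

(* The path algebra KQ: finitely supported K-valued functions on paths, with the
   K-module structure of {malg K[qpath Q]}. As Q may have no vertex, KQ is a
   possibly zero ring. The locks only prevent unfolding during unification. *)
Section PathAlgebra.
Variables (K : fieldType) (Q : quiver).

Definition pathalg : Type := {malg K[qpath Q]}.
HB.instance Definition _ := GRing.Lmodule.on pathalg.

Implicit Types x y z : pathalg.

Fact path_elt_key : unit. Proof. by []. Qed.
Definition path_elt : qpath Q -> pathalg :=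
  locked_with path_elt_key (fun p => << p >> : pathalg).

Lemma path_eltE p : path_elt p = << p >>.
Proof. by rewrite /path_elt unlock. Qed.

Definition path_mul (p q : qpath Q) : pathalg := oapp path_elt 0 (concat p q).

Fact pa_mul_key : unit. Proof. by []. Qed.
Definition pa_mul : pathalg -> pathalg -> pathalg :=
  locked_with pa_mul_key (fun x y =>
    \sum_(p <- msupp x) \sum_(q <- msupp y) (x@_p * y@_q) *: path_mul p q).

Definition pa_one : pathalg := \sum_(v : vertex Q) path_elt (trivial_path v).

Lemma pa_mulE x y : pa_mul x y =
  \sum_(p <- msupp x) \sum_(q <- msupp y) (x@_p * y@_q) *: path_mul p q.
Proof. by rewrite /pa_mul unlock. Qed.

Lemma mcoeff_path_elt p q : (path_elt p)@_q = (p == q)%:R.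
Proof. by rewrite path_eltE mcoeffU. Qed.

Lemma msupp_path_elt p : msupp (path_elt p) = [fset p].
Proof. by rewrite path_eltE msuppU oner_eq0. Qed.

Lemma pathalgE x : x = \sum_(p <- msupp x) x@_p *: path_elt p.
Proof.
rewrite [LHS]monalgE; apply: eq_bigr => p _; apply/malgP => q.
by rewrite mcoeffZ mcoeff_path_elt mcoeffU mulr_natr.
Qed.

Lemma pa_mulw (d1 d2 : {fset qpath Q}) x y :
  msupp x `<=` d1 -> msupp y `<=` d2 ->
  pa_mul x y = \sum_(p <- d1) \sum_(q <- d2) (x@_p * y@_q) *: path_mul p q.
Proof.
move=> le1 le2; rewrite pa_mulE (big_fset_incl _ le1) /=.
  apply: eq_bigr => p _; apply: big_fset_incl => // q _ /mcoeff_outdom ->.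
  by rewrite mulr0 scale0r.
move=> p _ /mcoeff_outdom xp.
by rewrite big1 // => q _; rewrite xp mul0r scale0r.
Qed.

Lemma pa_mulDl : left_distributive pa_mul +%R.
Proof.
move=> x y z.
rewrite (pa_mulw (msuppD_le x y) (fsubset_refl _)).
rewrite (pa_mulw (fsubsetUl (msupp x) (msupp y)) (fsubset_refl (msupp z))).
rewrite (pa_mulw (fsubsetUr (msupp x) (msupp y)) (fsubset_refl (msupp z))).
rewrite -big_split; apply: eq_bigr => p _ /=.
rewrite -big_split; apply: eq_bigr => q _ /=.
by rewrite mcoeffD mulrDl scalerDl.
Qed.

Lemma pa_mulDr : right_distributive pa_mul +%R.
Proof.
move=> z x y.
rewrite (pa_mulw (fsubset_refl _) (msuppD_le x y)).
rewrite (pa_mulw (fsubset_refl (msupp z)) (fsubsetUl (msupp x) (msupp y))).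
rewrite (pa_mulw (fsubset_refl (msupp z)) (fsubsetUr (msupp x) (msupp y))).
rewrite -big_split; apply: eq_bigr => p _ /=.
rewrite -big_split; apply: eq_bigr => q _ /=.
by rewrite mcoeffD mulrDr scalerDl.
Qed.

Lemma pa_mulZl (a : K) x y : pa_mul (a *: x) y = a *: pa_mul x y.
Proof.
rewrite (pa_mulw (msuppZ_le a x) (fsubset_refl _)) pa_mulE scaler_sumr.
apply: eq_bigr => p _; rewrite scaler_sumr; apply: eq_bigr => q _.
by rewrite mcoeffZ -mulrA scalerA.
Qed.

Lemma pa_mulZr (a : K) x y : pa_mul x (a *: y) = a *: pa_mul x y.
Proof.
rewrite (pa_mulw (fsubset_refl _) (msuppZ_le a y)) pa_mulE scaler_sumr.
apply: eq_bigr => p _; rewrite scaler_sumr; apply: eq_bigr => q _.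
by rewrite mcoeffZ mulrCA scalerA.
Qed.

Lemma pa_mul0l : left_zero 0 pa_mul.
Proof. by move=> x; rewrite -[0](scale0r x) pa_mulZl !scale0r. Qed.

Lemma pa_mul0r : right_zero 0 pa_mul.
Proof. by move=> x; rewrite -[0](scale0r x) pa_mulZr !scale0r. Qed.

Lemma pa_mulUU p q : pa_mul (path_elt p) (path_elt q) = path_mul p q.
Proof.
by rewrite pa_mulE !msupp_path_elt !big_seq_fset1 !mcoeff_path_elt !eqxx
  mulr1 scale1r.
Qed.

Lemma pa_mul_suml (I : Type) (r : seq I) (F : I -> pathalg) y :
  pa_mul (\sum_(i <- r) F i) y = \sum_(i <- r) pa_mul (F i) y.
Proof. exact: (big_morph (pa_mul^~ y) (fun _ _ => pa_mulDl _ _ _) (pa_mul0l _)). Qed.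

Lemma pa_mul_sumr (I : Type) (r : seq I) (F : I -> pathalg) x :
  pa_mul x (\sum_(i <- r) F i) = \sum_(i <- r) pa_mul x (F i).
Proof. exact: (big_morph (pa_mul x) (fun _ _ => pa_mulDr _ _ _) (pa_mul0r _)). Qed.

Lemma path_mulA p q r : pa_mul (path_elt p) (path_mul q r) =
  pa_mul (path_mul p q) (path_elt r).
Proof.
have := concatA p q r; rewrite /path_mul.
case: (concat q r) => [s|]; case: (concat p q) => [t|] /= E.
- by rewrite !pa_mulUU /path_mul E.
- by rewrite pa_mulUU /path_mul E pa_mul0l.
- by rewrite pa_mulUU /path_mul -E pa_mul0r.
- by rewrite pa_mul0l pa_mul0r.
Qed.

Lemma pa_mulA : associative pa_mul.
Proof.
move=> x y z; rewrite (pathalgE x) (pathalgE y) (pathalgE z).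
rewrite [LHS]pa_mul_suml [X in _ = pa_mul X _]pa_mul_suml [RHS]pa_mul_suml.
apply: eq_bigr => p _; rewrite !pa_mulZl; congr (_ *: _).
rewrite [X in pa_mul _ X = _]pa_mul_suml [X in _ = pa_mul X _]pa_mul_sumr.
rewrite [LHS]pa_mul_sumr [RHS]pa_mul_suml; apply: eq_bigr => q _.
rewrite [X in pa_mul _ X = _]pa_mulZl [X in _ = pa_mul X _]pa_mulZr.
rewrite [LHS]pa_mulZr [RHS]pa_mulZl; congr (_ *: _).
rewrite [X in pa_mul _ X = _]pa_mul_sumr [LHS]pa_mul_sumr [RHS]pa_mul_sumr.
apply: eq_bigr => r _; rewrite [X in pa_mul _ X = _]pa_mulZr.
rewrite [LHS]pa_mulZr [RHS]pa_mulZr; congr (_ *: _).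
by rewrite !pa_mulUU path_mulA.
Qed.

Lemma pa_mul1l : left_id pa_one pa_mul.
Proof.
move=> x; rewrite {1}(pathalgE x) [RHS]pathalgE pa_mul_sumr.
apply: eq_bigr => p _; rewrite pa_mulZr; congr (_ *: _).
rewrite /pa_one pa_mul_suml (bigD1 (path_start p)) //= big1 => [|v nv].
  by rewrite addr0 pa_mulUU /path_mul concat1p.
by rewrite pa_mulUU /path_mul concatN.
Qed.

Lemma pa_mul1r : right_id pa_one pa_mul.
Proof.
move=> x; rewrite {1}(pathalgE x) [RHS]pathalgE pa_mul_suml.
apply: eq_bigr => p _; rewrite pa_mulZl; congr (_ *: _).
rewrite /pa_one pa_mul_sumr (bigD1 (path_end p)) //= big1 => [|v nv].
  by rewrite addr0 pa_mulUU /path_mul concatp1.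
by rewrite pa_mulUU /path_mul concatN // eq_sym.
Qed.

HB.instance Definition _ := GRing.Zmodule_isPzRing.Build pathalg
  pa_mulA pa_mul1l pa_mul1r pa_mulDl pa_mulDr.

Lemma path_eltM p q : path_elt p * path_elt q = path_mul p q.
Proof. exact: pa_mulUU. Qed.

Lemma pathalg_scalerAl (a : K) x y : a *: (x * y) = (a *: x) * y.
Proof. by rewrite -[RHS]/(pa_mul _ _) pa_mulZl. Qed.

Lemma pathalg_scalerAr (a : K) x y : a *: (x * y) = x * (a *: y).
Proof. by rewrite -[RHS]/(pa_mul _ _) pa_mulZr. Qed.

Definition vertex_elt (v : vertex Q) : pathalg := path_elt (trivial_path v).
Definition arrow_elt (a : arrow Q) : pathalg := path_elt (arrow_path a).

Definition homogeneous (n : nat) : set pathalg :=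
  [set x | forall p, p \in msupp x -> path_length p = n].

End PathAlgebra.

(* Two-sided ideals, possibly improper. An ideal is a boolean predicate, as
   required by {quot I}; in the classical setting this is no restriction. *)
HB.mixin Record isTwoSided (R : pzRingType) (I : R -> bool) := {
  twoSided_mull : forall a u : R, I u -> I (a * u);
  twoSided_mulr : forall a u : R, I u -> I (u * a)
}.

#[short(type="twoSidedIdeal")]
HB.structure Definition TwoSidedIdeal (R : pzRingType) :=
  {I of GRing.ZmodClosed R I & isTwoSided R I}.

Section Ideals.
Variable R : pzRingType.

Definition ideal_span (S : set R) : set R :=
  [set x | forall L : twoSidedIdeal R, (forall s, S s -> s \in L) -> x \in L].

Definition ideal_mul (A B : set R) : set R :=
  ideal_span [set x | exists a b, [/\ A a, B b & x = a * b]].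

End Ideals.

(* The quotient algebra A = KQ/I; its additive structure is that of {quot I}. *)
Section QuotientAlgebra.
Variables (K : fieldType) (Q : quiver) (I : twoSidedIdeal (pathalg K Q)).
Local Notation R := (pathalg K Q).
Local Open Scope quotient_scope.

Definition quotalg : Type := Quotient.quot I.
HB.instance Definition _ := GRing.Zmodule.on quotalg.

Definition to_quot (x : R) : quotalg := \pi_(Quotient.quot I) x.

Definition qrepr (x : quotalg) : R := repr (x : Quotient.quot I).

Lemma to_quotE (x y : R) : to_quot x = to_quot y <-> x - y \in I.
Proof. by split=> [/eqP|h]; [|apply/eqP]; rewrite -Quotient.idealrBE. Qed.

Lemma qreprK (x : quotalg) : to_quot (qrepr x) = x.
Proof. exact: reprK. Qed.

Lemma to_quotD x y : to_quot (x + y) = to_quot x + to_quot y.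
Proof. exact: Quotient.pi_add. Qed.

Definition q_one : quotalg := to_quot 1.
Definition q_mul (x y : quotalg) : quotalg := to_quot (qrepr x * qrepr y).
Definition q_scale (a : K) (x : quotalg) : quotalg := to_quot (a *: qrepr x).

Lemma qrepr_pi x : qrepr (to_quot x) - x \in I.
Proof. by apply/to_quotE; rewrite qreprK. Qed.

Lemma q_mul_pi x y : q_mul (to_quot x) (to_quot y) = to_quot (x * y).
Proof.
apply/to_quotE; set x' := qrepr _; set y' := qrepr _.
have -> : x' * y' - x * y = x' * (y' - y) + (x' - x) * y.
  by rewrite mulrBr mulrBl addrA subrK.
by apply: rpredD; [apply: twoSided_mull|apply: twoSided_mulr]; exact: qrepr_pi.
Qed.

Lemma q_scale_pi a x : q_scale a (to_quot x) = to_quot (a *: x).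
Proof.
apply/to_quotE; rewrite -scalerBr -[_ - _]mul1r pathalg_scalerAl.
by apply: twoSided_mull; exact: qrepr_pi.
Qed.

Lemma q_mulA : associative q_mul.
Proof.
by move=> x y z; rewrite -[x]qreprK -[y]qreprK -[z]qreprK !q_mul_pi mulrA.
Qed.
Lemma q_mul1l : left_id q_one q_mul.
Proof. by move=> x; rewrite -[x]qreprK q_mul_pi mul1r. Qed.
Lemma q_mul1r : right_id q_one q_mul.
Proof. by move=> x; rewrite -[x]qreprK q_mul_pi mulr1. Qed.
Lemma q_mulDl : left_distributive q_mul +%R.
Proof.
move=> x y z; rewrite -[x]qreprK -[y]qreprK -[z]qreprK.
by rewrite -to_quotD !q_mul_pi mulrDl to_quotD.
Qed.
Lemma q_mulDr : right_distributive q_mul +%R.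
Proof.
move=> x y z; rewrite -[x]qreprK -[y]qreprK -[z]qreprK.
by rewrite -to_quotD !q_mul_pi mulrDr to_quotD.
Qed.

HB.instance Definition _ := GRing.Zmodule_isPzRing.Build quotalg
  q_mulA q_mul1l q_mul1r q_mulDl q_mulDr.

Lemma q_scaleA a b x : q_scale a (q_scale b x) = q_scale (a * b) x.
Proof. by rewrite -[x]qreprK !q_scale_pi scalerA. Qed.
Lemma q_scale1 : left_id 1 q_scale.
Proof. by move=> x; rewrite -[x]qreprK q_scale_pi scale1r. Qed.
Lemma q_scaleDr : right_distributive q_scale +%R.
Proof.
move=> a x y; rewrite -[x]qreprK -[y]qreprK.
by rewrite -to_quotD !q_scale_pi scalerDr to_quotD.
Qed.
Lemma q_scaleDl x : {morph q_scale^~ x : a b / a + b}.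
Proof. by move=> a b; rewrite -[x]qreprK !q_scale_pi scalerDl to_quotD. Qed.

HB.instance Definition _ := GRing.Zmodule_isLmodule.Build K quotalg
  q_scaleA q_scale1 q_scaleDr q_scaleDl.

Lemma to_quotM x y : to_quot (x * y) = to_quot x * to_quot y.
Proof. by rewrite -q_mul_pi. Qed.

Lemma to_quotZ a x : to_quot (a *: x) = a *: to_quot x.
Proof. by rewrite -q_scale_pi. Qed.

End QuotientAlgebra.

(* Dimension of a subspace of a K-module without a given finite basis. *)
Section Dimension.
Variables (K : fieldType) (V : lmodType K).

Definition is_basis (U : set V) (n : nat) (b : 'I_n -> V) : Prop :=
  (forall c : 'I_n -> K, \sum_i c i *: b i = 0 -> forall i, c i = 0) /\
  U = [set x | exists c : 'I_n -> K, x = \sum_i c i *: b i].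

Definition has_dim (U : set V) : set nat :=
  [set n | exists b : 'I_n -> V, is_basis U b].

(* 0 by convention if U is not a finite-dimensional subspace *)
Definition dim (U : set V) : nat := xget 0%N (has_dim U).

Definition finite_dim : Prop := exists n, has_dim setT n.

End Dimension.

Section Gentle.
Variables (K : fieldType) (Q : quiver) (I : twoSidedIdeal (pathalg K Q)).

Local Notation arr := (@arrow_elt K Q).

Definition arrow_ideal : set (pathalg K Q) := ideal_span (range arr).

Definition admissible : Prop :=
  forall x, x \in I -> ideal_mul arrow_ideal arrow_ideal x.

(* If target a <> source b then arr a * arr b = 0 lies in I. *)
Record gentle : Prop := Gentle {
  gentle_admissible : admissible;
  gentle_source : forall v : vertex Q, (#|[set a | source a == v]%SET| <= 2)%N;
  gentle_target : forall v : vertex Q, (#|[set a | target a == v]%SET| <= 2)%N;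
  gentle_next : forall a b b' : arrow Q,
    arr a * arr b \notin I -> arr a * arr b' \notin I -> b = b';
  gentle_prev : forall a c c' : arrow Q,
    arr c * arr a \notin I -> arr c' * arr a \notin I -> c = c';
  gentle_gen : exists2 S : set (qpath Q), (forall p, S p -> path_length p = 2)
    & forall x, x \in I <-> ideal_span [set path_elt K p | p in S] x;
  gentle_next0 : forall a b b' : arrow Q,
    target a = source b -> arr a * arr b \in I ->
    target a = source b' -> arr a * arr b' \in I -> b = b';
  gentle_prev0 : forall a c c' : arrow Q,
    target c = source a -> arr c * arr a \in I ->
    target c' = source a -> arr c' * arr a \in I -> c = c'
}.

Definition graded_piece (n : nat) : set (quotalg I) :=
  @to_quot K Q I @` @homogeneous K Q n.

Definition peirce_piece (v w : vertex Q) (n : nat) : set (quotalg I) :=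
  [set to_quot I (vertex_elt K v) * x * to_quot I (vertex_elt K w)
    | x in graded_piece n].

(* The sum over all n is finite as soon as quotalg I is finite-dimensional. *)
Definition qCartan_entry (v w : vertex Q) : {poly int} :=
  \sum_(n \in [set: nat]) ('X^n *+ dim (peirce_piece v w n) : {poly int}).

Definition qCartan : 'M[{poly int}]_#|vertex Q| :=
  \matrix_(i, j) qCartan_entry (enum_val i) (enum_val j).

Definition zero_rel : rel (arrow Q) :=
  fun a b => (target a == source b) && (arr a * arr b \in I).

Definition min_zero_cycle (k : nat) (p : k.-tuple (arrow Q)) : bool :=
  cycle zero_rel p && uniq p.

Definition rotations (k : nat) (p : k.-tuple (arrow Q)) :
    {set k.-tuple (arrow Q)} :=
  [set p' : k.-tuple (arrow Q) | [exists m : 'I_k, p' == [tuple of rot m p]]]%SET.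

Definition num_zero_cycles (k : nat) : nat :=
  #|[set rotations p | p : k.-tuple (arrow Q) & min_zero_cycle p]%SET|.

End Gentle.

Definition unimodularly_equivalent (R : comNzRingType) (n : nat)
    (C D : 'M[R]_n) : Prop :=
  exists P P' : 'M[R]_n, [/\ \det P = 1, \det P' = 1 & D = P *m C *m P'].

(* Main.v *)
Require Import Defs.
From HB Require Import structures.
From mathcomp Require Import all_boot all_order all_algebra.
From mathcomp Require Import finmap.
From mathcomp Require Import boolp classical_sets fsbigop.
From mathcomp.multinomials Require Import monalg.

Set Implicit Arguments.
Unset Strict Implicit.
Unset Printing Implicit Defensive.

Import GRing.Theory.
Local Open Scope ring_scope.

(** Write q for the indeterminate 'X.  For a set A of arrows let C(A) be the
matrix that counts, by length, the nonzero paths all of whose arrows lie in A,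
so that C of the set of all arrows is the q-Cartan matrix.  The theorem follows
by deleting the arrows one at a time, each deletion being a unimodular row or
column operation, until C = 1 is reached.

The operations are found as follows.  Let S be the vertex-arrow incidence
matrix of sources, q-weighted T the arrow-vertex incidence matrix of targets,
and N, Z the q-weighted arrow-arrow matrices of the composable pairs ab outside
I and inside I.  A composable pair is of exactly one of the two kinds, so
T S = N + Z.  With X the diagonal indicator matrix of A,

  C(A) = 1 + S X G,   G = (1 - N X)^-1 T,   H = S (1 - X N)^-1,

where the row G_a counts the nonzero paths that begin with the arrow a and the
column H_a those that can be continued by a.  The inverses exist over Z[q]
because finite dimension bounds the lengths of nonzero paths: an arrow has a
rank, the length of the longest nonzero path behind it, and N lowers the rank.
Then T S = N + Z gives

  T C(A) = (1 + Z X) G   and   C(A) S = H (1 + X Z),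

so that alternating sums of rows or columns of C(A) along a sequence of zero
relations telescope, while the resolvent identity says that deleting a from A
subtracts the rank one matrix H_a G_a, with H taken for A - a
(cartan_delete_arrow).

If some a in A is followed by no b in A with ab a zero relation, the first
identity reads q C_(t a) = G_a, and deleting a is a row operation
(cartan_delete_z_sink).  Otherwise zero relations define a successor map f on A,
which is injective because an arrow has at most one predecessor under zero
relations; so A is a union of zero cycles.  Choose a in A of minimal rank: no
nonzero path goes beyond a, so that a is the only arrow of A ending at t(a).
The telescoping sum of columns along the zero cycle of a, of length k, is
(1 - (-q)^k) times the unit vector of t(a), and adding these columns to the
column of t(a) turns C(A) into C(A - a) with this column, itself a unit vector,
multiplied by 1 - (-q)^k (cartan_delete_cycle).  So each deletion of this second
kind contributes one diagonal entry and destroys exactly one zero cycle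
(card_cycle_classes_delete); the induction is cartan_mx_diagonalizable.

That the q-Cartan matrix, defined through dimensions of pieces of the quotient
algebra, is this counting matrix (qCartanE) holds because I is a monomial ideal:
an element lies in I iff its coefficients at all nonzero paths vanish
(in_monomial_idealP), so the nonzero paths form a basis of the quotient. *)

(** * Dimension of subspaces *)

Section DimensionTheory.
Variables (K : fieldType) (V : lmodType K).

(** The matrix expressing the free family in the basis has trivial row kernel. *)
Lemma free_family_leq (U : set V) n m (b : 'I_n -> V) (b' : 'I_m -> V) :
  (forall c : 'I_n -> K, \sum_i c i *: b i = 0 -> forall i, c i = 0) ->
  (forall i, U (b i)) -> is_basis U b' -> (n <= m)%N.
Proof.
move=> b_free bU [_ UE].
have /fin_all_exists[M ME] i : exists c : 'I_m -> K, b i = \sum_j c j *: b' j.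
  by have := bU i; rewrite UE.
pose Mx : 'M[K]_(n, m) := \matrix_(i, j) M i j.
suff /eqP <- : row_free Mx by apply: rank_leq_col.
rewrite -kermx_eq0; apply/eqP/row_matrixP => r; rewrite row0.
set u := row r _; have uM : u *m Mx = 0 by rewrite -row_mul mulmx_ker row0.
apply/rowP => i; rewrite [RHS]mxE; apply: (b_free (u 0)); clear i.
under eq_bigr => i _ do rewrite ME scaler_sumr.
rewrite exchange_big big1 //= => j _.
under eq_bigr => i _ do rewrite scalerA.
have : (u *m Mx) 0 j = 0 by rewrite uM mxE.
rewrite mxE -scaler_suml => uM0; rewrite (_ : \sum_i _ = 0) ?scale0r // -[RHS]uM0.
by apply: eq_bigr => i _; rewrite [Mx _ _]mxE.
Qed.

Lemma dim_basis (U : set V) n (b : 'I_n -> V) : is_basis U b -> Defs.dim U = n.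
Proof.
have mem k (c : 'I_k -> V) i : is_basis U c -> U (c i).
  move=> [_ ->]; exists (fun j => (j == i)%:R).
  rewrite (bigD1 i) //= big1 => [|j /negPf->]; last by rewrite scale0r.
  by rewrite eqxx scale1r addr0.
move=> bU; apply: xget_unique => [|m [b' b'U]]; first by exists b.
apply/eqP; rewrite eqn_leq.
rewrite (free_family_leq b'U.1 (fun i => mem _ _ i b'U) bU).
by rewrite (free_family_leq bU.1 (fun i => mem _ _ i bU) b'U).
Qed.

End DimensionTheory.

(** * The quotient by a quadratic monomial ideal *)

Section MonomialIdeal.
Variables (K : fieldType) (Q : quiver) (I : twoSidedIdeal (pathalg K Q)).
Local Notation arr := (@arrow_elt K Q).
Local Notation R := (pathalg K Q).
Implicit Types (p q r : qpath Q) (x y : R).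

Definition nonzero_rel : rel (arrow Q) :=
  fun a b => (target a == source b) && (arr a * arr b \notin I).

Definition nonzero_path p := sorted nonzero_rel (path_arrows p).

Lemma path_elt_cons p q a : path_start p = source a ->
  path_start q = target a -> path_arrows p = a :: path_arrows q ->
  path_elt K p = arr a * path_elt K q.
Proof.
move=> ps qs pa; rewrite path_eltM /path_mul.
have [|r -> rE] := @concatP _ (arrow_path a) q; first by rewrite qs.
congr (path_elt _ _); apply: val_inj; rewrite rE.
by rewrite [LHS]surjective_pairing -/(path_arrows p) pa -/(path_start p) ps.
Qed.

Lemma walk_consP v a s : walk v (a :: s) ->
  exists p q : qpath Q, [/\ val p = (v, a :: s), val q = (target a, s) &
    path_elt K p = arr a * path_elt K q].
Proof.
move=> vas; have /= /andP[/eqP av as_] := vas.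
pose p : qpath Q := exist _ (v, a :: s) vas.
pose q : qpath Q := exist _ (target a, s) as_.
exists p, q; split=> //; apply: path_elt_cons => //.
Qed.

(** Peel off arrows until the first zero relation is in front. *)
Lemma zero_path_in_ideal p : ~~ nonzero_path p -> path_elt K p \in I.
Proof.
suff H s v q : val q = (v, s) -> ~~ sorted nonzero_rel s -> path_elt K q \in I.
  exact: H (surjective_pairing _).
elim: s v q => {p} // a s IH v p pE.
have [|p' [q [p'E qE pM]]] := @walk_consP v a s.
  by have := valP p; rewrite pE.
have -> : p = p' by apply: val_inj; rewrite pE p'E.
rewrite pM {p pE p' p'E pM}; case: s => // b s in IH qE *.
rewrite /= negb_and => /orP[ab|s0]; last first.
  by apply: twoSided_mull; apply: (IH (target a)).
have w : walk (target a) (b :: s) by have := valP q; rewrite qE.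
have [q' [r [q'E rE qM]]] := walk_consP w.
have -> : q = q' by apply: val_inj; rewrite qE q'E.
rewrite qM mulrA; apply: twoSided_mulr.
by have /= /andP[/eqP ba _] := w; move: ab; rewrite /nonzero_rel ba eqxx negbK.
Qed.

Lemma nonzero_path_concat p q r : concat p q = Some r -> nonzero_path r ->
  nonzero_path p /\ nonzero_path q.
Proof.
have [pq|pq] := eqVneq (path_end p) (path_start q); last by rewrite concatN.
have [r' -> r'E] := concatP pq; move=> [<-].
rewrite /nonzero_path {1}/path_arrows r'E /=.
case: (path_arrows p) (path_arrows q) => [|a s] s'; rewrite ?cat0s //.
by rewrite /= cat_path => /andP[-> /path_sorted].
Qed.

Lemma mcoeff_sum (T : Type) (l : seq T) (P : pred T) (F : T -> R) p :
  (\sum_(i <- l | P i) F i)@_p = \sum_(i <- l | P i) (F i)@_p.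
Proof. exact: (big_morph (mcoeff p) (mcoeffD p) (mcoeff0 p)). Qed.

Lemma mcoeff_mul x y p : (x * y)@_p =
  \sum_(q <- msupp x) \sum_(r <- msupp y)
    x@_q * y@_r * (concat q r == Some p)%:R.
Proof.
rewrite -[x * y]/(pa_mul x y) pa_mulE mcoeff_sum; apply: eq_bigr => q _.
rewrite mcoeff_sum; apply: eq_bigr => r _; rewrite mcoeffZ /path_mul.
by case: (concat q r) => [s|]; rewrite /= ?mcoeff_path_elt ?mcoeff0.
Qed.

(** The span of the paths containing a zero relation, described by vanishing
coefficients.  It is an ideal because a factor of a nonzero path is nonzero. *)
Definition zero_paths_span : R -> bool :=
  fun x => `[< forall p, nonzero_path p -> x@_p = 0 >].

Lemma zero_paths_spanP x :
  reflect (forall p, nonzero_path p -> x@_p = 0) (x \in zero_paths_span).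
Proof. exact: asboolP. Qed.

Lemma zero_paths_span_zmod : zmod_closed zero_paths_span.
Proof.
split=> [|x y /zero_paths_spanP x0 /zero_paths_spanP y0].
  by apply/zero_paths_spanP => p _; rewrite mcoeff0.
by apply/zero_paths_spanP => p pn; rewrite mcoeffB x0 // y0 // subr0.
Qed.

Lemma zero_paths_span_mull x y : zero_paths_span y -> zero_paths_span (x * y).
Proof.
move=> /zero_paths_spanP y0; apply/zero_paths_spanP => p pn; rewrite mcoeff_mul.
rewrite big1 // => q _; rewrite big1 // => r _; case: eqP => [qr|]; last first.
  by rewrite mulr0.
by rewrite y0 ?mulr0 ?mul0r //; have [] := nonzero_path_concat qr pn.
Qed.

Lemma zero_paths_span_mulr x y : zero_paths_span y -> zero_paths_span (y * x).
Proof.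
move=> /zero_paths_spanP y0; apply/zero_paths_spanP => p pn; rewrite mcoeff_mul.
rewrite big1 // => q _; rewrite big1 // => r _; case: eqP => [qr|]; last first.
  by rewrite mulr0.
by rewrite y0 ?mul0r //; have [] := nonzero_path_concat qr pn.
Qed.

HB.instance Definition _ :=
  GRing.isZmodClosed.Build R zero_paths_span zero_paths_span_zmod.
HB.instance Definition _ :=
  isTwoSided.Build R zero_paths_span zero_paths_span_mull zero_paths_span_mulr.

Lemma ideal_scale (c : K) x : x \in I -> c *: x \in I.
Proof. by move=> xI; rewrite -[x]mul1r pathalg_scalerAl; apply: twoSided_mull. Qed.

Section Quadratic.
Variable S : set (qpath Q).
Hypothesis S_length : forall p, S p -> path_length p = 2.
Hypothesis S_span :
  forall x, x \in I <-> ideal_span [set path_elt K p | p in S]%classic x.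

(** The span of the zero paths is an ideal containing the generators of I, so it
contains I; conversely every zero path lies in I. *)
Lemma in_monomial_idealP x :
  x \in I <-> (forall p, nonzero_path p -> x@_p = 0).
Proof.
split=> [/S_span xS|x0].
  have {}xS := xS (TwoSidedIdeal.clone R zero_paths_span _).
  apply/zero_paths_spanP; apply: xS => y [p Sp <-].
  apply/zero_paths_spanP => r; rewrite mcoeff_path_elt; case: eqP => // <-.
  have pI : path_elt K p \in I by apply/S_span => L; apply; exists p.
  have := S_length Sp; rewrite /path_length /nonzero_path.
  case pE: (path_arrows p) => [|a [|b []]] //= _.
  have vE : val p = (path_start p, [:: a; b]) by rewrite -pE -surjective_pairing.
  have w : walk (path_start p) [:: a; b] by have := valP p; rewrite vE.
  have [p' [q [p'E qE pM]]] := walk_consP w.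
  have /= /and3P[_ ba _] := w.
  have qM : q = arrow_path b by apply: val_inj; rewrite qE -(eqP ba).
  rewrite (_ : p = p') in pI; last by apply: val_inj; rewrite vE p'E.
  by rewrite pM qM in pI; rewrite /nonzero_rel pI andbF.
rewrite (pathalgE x); apply: rpred_sum => p _.
have [pn|pn] := boolP (nonzero_path p); first by rewrite x0 // scale0r rpred0.
exact/ideal_scale/zero_path_in_ideal.
Qed.

Lemma to_quot0 : to_quot I 0 = 0.
Proof. by apply: (addrI (to_quot I 0)); rewrite -to_quotD !addr0. Qed.

Lemma to_quot_sum (T : Type) (l : seq T) (F : T -> R) :
  to_quot I (\sum_(i <- l) F i) = \sum_(i <- l) to_quot I (F i).
Proof. exact: (big_morph (to_quot I) (@to_quotD _ _ I) to_quot0). Qed.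

Lemma mcoeff_family n (c : 'I_n -> K) (P : 'I_n -> qpath Q) p :
  (\sum_i c i *: path_elt K (P i))@_p = \sum_i c i *+ (P i == p).
Proof.
rewrite mcoeff_sum; apply: eq_bigr => i _.
by rewrite mcoeffZ mcoeff_path_elt mulr_natr.
Qed.

Lemma nonzero_paths_free n (P : 'I_n -> qpath Q) (c : 'I_n -> K) :
  injective P -> (forall i, nonzero_path (P i)) ->
  \sum_i c i *: to_quot I (path_elt K (P i)) = 0 -> forall i, c i = 0.
Proof.
move=> Pinj Pn c0 i.
have : \sum_i c i *: path_elt K (P i) \in I.
  rewrite -[X in X \in I]subr0; apply/to_quotE; rewrite to_quot0 -c0 to_quot_sum.
  by apply: eq_bigr => j _; rewrite to_quotZ.
move=> /in_monomial_idealP/(_ (P i) (Pn i)); rewrite mcoeff_family.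
rewrite (bigD1 i) //= big1 ?addr0 ?eqxx // => j /negPf ji.
by rewrite (inj_eq Pinj) ji.
Qed.

Definition nonzero_walks n v w : {set n.-tuple (arrow Q)} :=
  [set u : n.-tuple (arrow Q) | [&& walk v u, sorted nonzero_rel u &
    last v [seq target a | a <- u] == w]]%SET.

Lemma mcoeff_vertex_mull v x p :
  (vertex_elt K v * x)@_p = x@_p *+ (path_start p == v).
Proof.
rewrite {1}(pathalgE x) [in RHS](pathalgE x) mulr_sumr !mcoeff_sum -sumrMnl.
apply: eq_bigr => q _; rewrite -pathalg_scalerAr.
rewrite [LHS]mcoeffZ.
rewrite [X in _ = X *+ _]mcoeffZ.
rewrite /vertex_elt [path_elt _ _ * _]path_eltM /path_mul.
have [<-|qv] := eqVneq (path_start q) v.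
  rewrite concat1p mcoeff_path_elt; case: eqP => [->|]; rewrite ?eqxx //.
  by rewrite mulr0 mul0rn.
rewrite concatN; last by rewrite eq_sym.
rewrite mcoeff0 mulr0 mcoeff_path_elt.
by case: eqP => [<-|_]; rewrite ?(negPf qv) ?mulr0n ?mulr0 ?mul0rn.
Qed.

Lemma mcoeff_vertex_mulr v x p :
  (x * vertex_elt K v)@_p = x@_p *+ (path_end p == v).
Proof.
rewrite {1}(pathalgE x) [in RHS](pathalgE x) mulr_suml !mcoeff_sum -sumrMnl.
apply: eq_bigr => q _; rewrite -pathalg_scalerAl.
rewrite [LHS]mcoeffZ.
rewrite [X in _ = X *+ _]mcoeffZ.
rewrite /vertex_elt [path_elt _ _ * _]path_eltM /path_mul.
have [<-|qv] := eqVneq (path_end q) v.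
  rewrite concatp1 mcoeff_path_elt; case: eqP => [->|]; rewrite ?eqxx //.
  by rewrite mulr0 mul0rn.
rewrite concatN // mcoeff0 mulr0 mcoeff_path_elt.
by case: eqP => [<-|_]; rewrite ?(negPf qv) ?mulr0n ?mulr0 ?mul0rn.
Qed.

(** The classes of the nonzero paths of length n from v to w form a basis. *)
Lemma dim_peirce_piece v w n :
  Defs.dim (@peirce_piece K Q I v w n) = #|nonzero_walks n v w|.
Proof.
pose P (i : 'I_#|nonzero_walks n v w|) : qpath Q :=
  insubd (trivial_path v) (v, tval (enum_val i)).
have PE i : val (P i) = (v, tval (enum_val i)).
  rewrite insubdK //; have := enum_valP i; rewrite inE => /and3P[].
  by rewrite -topredE.
have Pinj : injective P.
  move=> i j /(congr1 val); rewrite !PE => -[] /val_inj; exact: enum_val_inj.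
have Pn i : nonzero_path (P i).
  rewrite /nonzero_path /path_arrows PE.
  by have := enum_valP i; rewrite inE => /and3P[].
have Pend i : path_end (P i) = w.
  rewrite /path_end /path_start /path_arrows PE.
  by have := enum_valP i; rewrite inE => /and3P[_ _ /eqP].
have Psize i : path_length (P i) = n.
  by rewrite /path_length /path_arrows PE size_tuple.
have Ponto p : nonzero_path p -> path_start p = v -> path_end p = w ->
    path_length p = n -> exists i, P i = p.
  move=> pn pv pw pl; have sz : size (path_arrows p) == n by apply/eqP.
  have uP : Tuple sz \in nonzero_walks n v w.
    rewrite inE /= -pv; have := valP p; rewrite /= => ->.
    by rewrite -/(nonzero_path p) pn -pw /path_end eqxx.
  exists (enum_rank_in uP (Tuple sz)); apply: val_inj.
  rewrite PE enum_rankK_in //= -pv; exact/esym/surjective_pairing.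
apply: (dim_basis (b := fun i => to_quot I (path_elt K (P i)))); split.
  by move=> c; apply: nonzero_paths_free.
(* Modulo I, multiplying by the idempotents of v and w keeps exactly the
   coefficients at the paths P i. *)
have proj y : (forall p, p \in msupp y -> path_length p = n) ->
    to_quot I (vertex_elt K v * y * vertex_elt K w) =
    \sum_i y@_(P i) *: to_quot I (path_elt K (P i)).
  move=> yn; under eq_bigr => i _ do rewrite -to_quotZ.
  rewrite -to_quot_sum; apply/to_quotE/in_monomial_idealP => p pn.
  rewrite mcoeffB mcoeff_vertex_mulr mcoeff_vertex_mull mcoeff_family.
  apply/eqP; rewrite subr_eq0; apply/eqP.
  have [[i Pip]|noP] := EM (exists i, P i = p).
    rewrite (bigD1 i) //= big1 => [|j /negPf ji]; last first.
      by rewrite -Pip (inj_eq Pinj) ji.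
    by rewrite -Pip Pend /path_start PE !eqxx addr0.
  rewrite big1 => [|i _]; last by case: eqP => // Pip; case: noP; exists i.
  have [/yn pl|/mcoeff_outdom->] := boolP (p \in msupp y); last by rewrite !mul0rn.
  case: eqP => [pv|_]; last by rewrite ?mulr0n ?mul0rn.
  case: eqP => [pw|_]; last by rewrite ?mulr0n ?mul0rn.
  by case: noP; apply: Ponto.
apply/predeqP => X; split=> [[_ [y yn <-] <-]|[c ->]].
  by exists (fun i => y@_(P i)); rewrite -!to_quotM proj.
pose y := \sum_i c i *: path_elt K (P i).
have yE i : y@_(P i) = c i.
  rewrite /y mcoeff_family (bigD1 i) //= eqxx big1 ?addr0 // => j /negPf ji.
  by rewrite (inj_eq Pinj) ji.
have yn p : p \in msupp y -> path_length p = n.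
  rewrite -mcoeff_neq0 /y mcoeff_family => py.
  apply: contrapT => pl; move/eqP: py; apply; rewrite big1 // => i _.
  by case: eqP => // Pip; rewrite -Pip in pl.
move: y yE yn => y yE yn; exists (to_quot I y); first by exists y.
rewrite -!to_quotM proj; last exact: yn.
by apply: eq_bigr => i _; rewrite yE.
Qed.

(** The initial segments of a nonzero path are nonzero and of distinct lengths,
hence linearly independent in the quotient. *)
Lemma nonzero_path_bounded : finite_dim (quotalg I) ->
  exists m, forall p, nonzero_path p -> (path_length p < m)%N.
Proof.
move=> [m [b bT]]; exists m => p pn; rewrite ltnNge; apply/negP => mp.
pose P (i : 'I_m.+1) : qpath Q :=
  insubd (trivial_path (path_start p)) (path_start p, take i (path_arrows p)).
have PE i : val (P i) = (path_start p, take i (path_arrows p)).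
  rewrite insubdK // -topredE /=; have := valP p.
  by rewrite -{1}(cat_take_drop i (val p).2) walk_cat => /andP[].
suff : (m.+1 <= m)%N by rewrite ltnn.
apply: (free_family_leq (b := fun i => to_quot I (path_elt K (P i))) _ _ bT) => //.
move=> c; apply: nonzero_paths_free => [i j /(congr1 val)|i].
  rewrite !PE => -[] /(congr1 size); rewrite !size_take_min.
  have le (l : 'I_m.+1) : (l <= size (path_arrows p))%N.
    by apply: leq_trans mp; rewrite -ltnS.
  by rewrite !(minn_idPl (le _)) => /val_inj.
rewrite /nonzero_path /path_arrows PE.
have := pn; rewrite /nonzero_path -{1}(cat_take_drop i (path_arrows p)).
by case: (take i _) => //= a s; rewrite cat_path => /andP[].
Qed.

End Quadratic.
End MonomialIdeal.

Lemma geometric_series_mx (R : comNzRingType) p m (M : 'M[R]_p) :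
  M ^+ m = 0 ->
  (1%:M - M) *m (\sum_(k < m) M ^+ k) = 1%:M /\
  (\sum_(k < m) M ^+ k) *m (1%:M - M) = 1%:M.
Proof.
move=> M0; have comm : GRing.comm M (\sum_(k < m) M ^+ k).
  by apply: commr_sum => k _; apply: commrX.
have E : (1%:M - M) *m (\sum_(k < m) M ^+ k) = 1%:M.
  have := subrX1 M m; rewrite M0 sub0r => /(congr1 -%R).
  by rewrite opprK -mulNr opprB; exact: esym.
split=> //; rewrite -[RHS]E mulmxBl mulmxBr mul1mx mulmx1.
congr (_ - _); exact: esym comm.
Qed.

(** The matrix differs from the identity in column w only, and its entry there
is 1: expand along row w. *)
Lemma det_rank_one_update (R : comNzRingType) p (u : 'cV[R]_p) (w : 'I_p) :
  u w 0 = 0 -> \det (1%:M + u *m delta_mx 0 w) = 1.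
Proof.
move=> uw0; have uE i j : (u *m delta_mx 0 w) i j = u i 0 *+ (j == w).
  by rewrite mxE big_ord1 !mxE eqxx /= mulr_natr.
rewrite (expand_det_row _ w) (bigD1 w) //= big1 => [|j jw]; last first.
  by rewrite mxE uE uw0 mul0rn addr0 mxE eq_sym (negPf jw) mul0r.
rewrite mxE uE uw0 mul0rn addr0 mxE eqxx mulr1n addr0.
rewrite mul1r /cofactor addnn -signr_odd odd_double expr0 mul1r.
rewrite -[RHS](det1 R (p.-1)); congr (\det _); apply/matrixP => i j.
rewrite 2![LHS]mxE [LHS]mxE uE eq_sym (negPf (neq_lift _ _)) mulr0n addr0.
by rewrite !mxE (inj_eq lift_inj).
Qed.

(** * Path counting matrices of sets of arrows *)

Section WeightedMatrices.
Variables (E : finType) (n : nat) (s t : E -> 'I_n) (z : rel E).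
Variables (rho : E -> nat) (m : nat).
Implicit Types (A : {set E}) (a b c : E).
Local Notation R := {poly int}.

(** The relation z stands for the zero relations ab in I, which determine the
nonzero composable pairs. *)
Definition composable_nonzero : rel E := fun a b => (t a == s b) && ~~ z a b.
Local Notation nz := composable_nonzero.

Hypothesis z_composable : forall a b, z a b -> t a = s b.
(* In the application rho a is the length of the longest nonzero path behind a. *)
Hypothesis rho_decr : forall a b, nz a b -> (rho b < rho a)%N.
Hypothesis rho_bound : forall a, (rho a < m)%N.

Definition source_mx : 'M[R]_(n, #|E|) :=
  \matrix_(i, j) (s (enum_val j) == i)%:R.
Definition target_mx : 'M[R]_(#|E|, n) :=
  \matrix_(i, j) ('X *+ (t (enum_val i) == j)).
Definition rel_mx (r : rel E) : 'M[R]_#|E| :=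
  \matrix_(i, j) ('X *+ r (enum_val i) (enum_val j)).
Definition restr_mx A : 'M[R]_#|E| :=
  diag_mx (\row_i (enum_val i \in A)%:R).

Local Notation S := source_mx.
Local Notation T := target_mx.
Local Notation N := (rel_mx nz).
Local Notation Z := (rel_mx z).
Local Notation X := restr_mx.

(** The resolvents (1 - X N)^-1 and (1 - N X)^-1.  The geometric series may stop
at m, which exceeds all ranks, so that m-th powers vanish. *)
Definition lresolvent A := \sum_(k < m) (X A *m N) ^+ k.
Definition rresolvent A := \sum_(k < m) (N *m X A) ^+ k.
Local Notation L := lresolvent.
Local Notation R_ := rresolvent.

Definition cartan_mx A : 'M[R]_n := 1%:M + S *m X A *m R_ A *m T.
Local Notation C := cartan_mx.

(** An arrow pair is composable iff exactly one of the two relations holds. *)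
Lemma target_source_mx : T *m S = N + Z.
Proof.
apply/matrixP => i j; rewrite !mxE (bigD1 (t (enum_val i))) //= big1.
  rewrite !mxE eqxx addr0 mulr_natr /composable_nonzero eq_sym.
  case: (boolP (z _ _)) => [/z_composable->|_]; first by rewrite eqxx add0r.
  by rewrite andbT addr0.
by move=> k /negPf kt; rewrite !mxE eq_sym kt mul0r.
Qed.

Lemma restr_mulE A p (M : 'M[R]_(#|E|, p)) i j :
  (X A *m M) i j = M i j *+ (enum_val i \in A).
Proof. by rewrite mul_diag_mx !mxE mulr_natl. Qed.

Lemma mul_restrE A p (M : 'M[R]_(p, #|E|)) i j :
  (M *m X A) i j = M i j *+ (enum_val j \in A).
Proof. by rewrite mul_mx_diag !mxE mulr_natr. Qed.

(** A filtration in place of strict triangularity: the arrows need not be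
numbered compatibly with their ranks. *)
Definition lowers_rank k (M : 'M[R]_#|E|) : Prop := forall i j,
  (rho (enum_val i) < rho (enum_val j) + k)%N -> M i j = 0.

Lemma lowers_rankM k l M M' :
  lowers_rank k M -> lowers_rank l M' -> lowers_rank (k + l) (M *m M').
Proof.
move=> hM hM' i j lt; rewrite mxE big1 // => h _.
case: (ltnP (rho (enum_val i)) (rho (enum_val h) + k)) => [/hM->|le1].
  by rewrite mul0r.
rewrite [M' _ _]hM' ?mulr0 // -(ltn_add2r k) (leq_ltn_trans le1) //.
by rewrite -addnA [(l + k)%N]addnC.
Qed.

Lemma lowers_rankX k M : lowers_rank 1 M -> lowers_rank k (M ^+ k).
Proof.
move=> hM; elim: k => [i j|k IH]; rewrite ?expr0.
  by rewrite addn0 mxE; case: eqP => // ->; rewrite ltnn.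
by rewrite exprS -add1n; apply: lowers_rankM.
Qed.

Lemma lowers_rank_nilp M : lowers_rank 1 M -> M ^+ m = 0.
Proof.
move=> /(@lowers_rankX m) hM; apply/matrixP => i j; rewrite hM ?mxE //.
by rewrite ltn_addl.
Qed.

Lemma lowers_rank_rel : lowers_rank 1 N.
Proof.
move=> i j lt; rewrite mxE; case: (boolP (nz _ _)) => [/rho_decr|//].
by rewrite addn1 ltnS leqNgt in lt; rewrite (negPf lt).
Qed.

Lemma lowers_rank_restr A : lowers_rank 0 (X A).
Proof.
move=> i j; rewrite addn0 mxE; case: eqP => [->|//]; first by rewrite ltnn.
Qed.

Lemma lowers_rank_lr A : lowers_rank 1 (X A *m N).
Proof. exact: lowers_rankM (lowers_rank_restr A) lowers_rank_rel. Qed.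

Lemma lowers_rank_rr A : lowers_rank 1 (N *m X A).
Proof. exact: lowers_rankM lowers_rank_rel (lowers_rank_restr A). Qed.

Lemma rresolventV A : (1%:M - N *m X A) *m R_ A = 1%:M.
Proof. exact: (geometric_series_mx (lowers_rank_nilp (@lowers_rank_rr A))).1. Qed.

Lemma lresolventV A : L A *m (1%:M - X A *m N) = 1%:M.
Proof. exact: (geometric_series_mx (lowers_rank_nilp (@lowers_rank_lr A))).2. Qed.

Lemma rresolventE A : R_ A = 1%:M + N *m X A *m R_ A.
Proof. by rewrite -[X in _ = X + _](rresolventV A) mulmxBl mul1mx subrK. Qed.

Lemma lresolventE A : L A = 1%:M + L A *m X A *m N.
Proof. by rewrite -[X in _ = X + _](lresolventV A) mulmxBr mulmx1 mulmxA subrK. Qed.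

Lemma resolvent_swap A : X A *m R_ A = L A *m X A.
Proof.
rewrite -[LHS]mul1mx -[X in X *m _](lresolventV A).
rewrite -[RHS]mulmx1 -[X in _ = _ *m X](rresolventV A).
rewrite -!mulmxA; congr (_ *m _); rewrite !mulmxA; congr (_ *m _).
by rewrite mulmxBl mulmxBr mul1mx mulmx1 mulmxA.
Qed.

Lemma cartan_mxE A : C A = 1%:M + S *m L A *m X A *m T.
Proof. by rewrite /cartan_mx -!mulmxA (mulmxA (X A)) resolvent_swap !mulmxA. Qed.

(** The row identity: T C = T + (N + Z) X G, where T + N X G = G. *)
Lemma target_cartan A : T *m C A = (1%:M + Z *m X A) *m (R_ A *m T).
Proof.
rewrite mulmxDr mulmx1 !mulmxA target_source_mx !mulmxDl.
rewrite [in RHS]mul1mx {3}rresolventE mulmxDl mul1mx.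
by rewrite !addrA.
Qed.

(** The column identity: C S = S + H X (N + Z), where S + H X N = H. *)
Lemma cartan_source A : C A *m S = S *m L A *m (1%:M + X A *m Z).
Proof.
rewrite cartan_mxE mulmxDl mul1mx -!mulmxA target_source_mx !mulmxDr mulmx1.
by rewrite {3}(lresolventE A) mulmxDr mulmx1 !mulmxA !addrA.
Qed.

(** The second resolvent identity, in the mixed form that uses the resolvent of
A' on the left and that of A on the right. *)
Lemma resolvent_diff A A' :
  X A *m R_ A - X A' *m R_ A' = L A' *m (X A - X A') *m R_ A.
Proof.
rewrite (resolvent_swap A') -[X A *m R_ A]mul1mx.
rewrite -[X in X *m _ - _](lresolventV A').
rewrite -[X in _ - X]mulmx1 -[X in _ - _ *m X](rresolventV A).
rewrite -!mulmxA -mulmxBr.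
congr (_ *m _); rewrite !mulmxA -mulmxBl; congr (_ *m _).
by rewrite mulmxBr mulmxBl mul1mx mulmx1 mulmxA opprB addrA subrK.
Qed.

Lemma restr_mxD1 A a : a \in A ->
  X A - X (A :\ a) = delta_mx (enum_rank a) (enum_rank a).
Proof.
move=> aA; apply/matrixP => i j; rewrite !mxE !inE.
rewrite -(can_eq enum_valK i) -(can_eq enum_valK j) !enum_rankK.
rewrite -(can_eq enum_valK i j).
case: (eqVneq (enum_val i) a) => [->|ia] /=.
  by rewrite aA mul0rn subr0 eq_sym.
by rewrite subrr.
Qed.

(** A nonzero path through a splits at the first occurrence of a into a path in
A - a that can be continued by a and a path in A that begins with a; both parts
are arbitrary, which makes the difference a column times a row. *)
Lemma cartan_delete_arrow A a : a \in A ->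
  C A - C (A :\ a) = S *m L (A :\ a) *m col (enum_rank a) 1%:M *m
    row (enum_rank a) (R_ A *m T).
Proof.
move=> aA; rewrite /cartan_mx opprD addrACA subrr add0r -mulmxBl.
rewrite -!(mulmxA S) -mulmxBr resolvent_diff restr_mxD1 //.
rewrite colE [row _ _]rowE mul1mx !mulmxA; congr (_ *m _ *m _).
by rewrite -!mulmxA mul_delta_mx.
Qed.


Lemma mul_sourceE p (M : 'M[R]_(p, n)) i a :
  (M *m S) i (enum_rank a) = M i (s a).
Proof.
rewrite mxE (bigD1 (s a)) //= big1 => [|j /negPf ja].
  by rewrite mxE enum_rankK eqxx mulr1 addr0.
by rewrite mxE enum_rankK eq_sym ja mulr0.
Qed.

Lemma target_mulE p (M : 'M[R]_(n, p)) a j :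
  (T *m M) (enum_rank a) j = 'X * M (t a) j.
Proof.
rewrite mxE (bigD1 (t a)) //= big1 => [|i /negPf ja].
  by rewrite mxE enum_rankK eqxx mulr1n addr0.
by rewrite mxE enum_rankK eq_sym ja mul0r.
Qed.

Lemma row_target a : row (enum_rank a) T = 'X *: delta_mx 0 (t a).
Proof.
apply/rowP => j; rewrite !mxE enum_rankK eqxx /= eq_sym.
by rewrite mulr_natr.
Qed.

Lemma rel_mxE r a b : rel_mx r (enum_rank a) (enum_rank b) = 'X *+ r a b.
Proof. by rewrite mxE !enum_rankK. Qed.

(** If no zero relation of A leaves a, row a of the row identity says that
q times row (t a) of C(A) is G_a, hence C(A - a) = (1 - q H_a e) C(A) with e the
unit row vector of t a.  This factor has determinant 1: the entry of H_a at t a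
counts paths from t a that can be continued by a, and such a path would close up
with a either to a closed nonzero path, which the rank forbids, or to a path
whose first pair is a zero relation leaving a. *)
Lemma cartan_delete_z_sink A a : a \in A -> (forall b, b \in A -> ~~ z a b) ->
  exists2 P, \det P = 1 & P *m C A = C (A :\ a).
Proof.
move=> aA azA; pose ia := enum_rank a; pose A' := A :\ a.
have rowZ (B : {set E}) : B \subset A -> row ia (Z *m X B) = 0.
  move=> /fintype.subsetP sBA; apply/rowP => j.
  rewrite mxE mul_restrE !mxE enum_rankK.
  case: (boolP (_ \in B)) => [/sBA /azA/negPf->|_]; by rewrite ?mulr0n.
pose u := S *m L A' *m col ia 1%:M.
have uE : u = col ia (S *m L A') by rewrite [in RHS]colE /u colE mul1mx.
exists (1%:M + (- 'X *: u) *m delta_mx 0 (t a)).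
  apply: det_rank_one_update; rewrite uE [LHS]mxE [X in _ * X]mxE mulNr.
  (* q times the entry of H_a at t a is the entry of (N + Z) L at (a, a). *)
  rewrite -target_mulE mulmxA target_source_mx mulmxDl mxE.
  have -> : (N *m L A') ia ia = 0.
    rewrite /lresolvent mulmx_sumr summxE big1 // => k _.
    apply: (lowers_rankM lowers_rank_rel (lowers_rankX (@lowers_rank_lr A'))).
    by rewrite add1n addnS ltnS leq_addr.
  rewrite lresolventE mulmxDr mulmx1 -(resolvent_swap A') -!mulmxA !mulmxA.
  have -> : (Z + Z *m X A' *m R_ A' *m N) ia ia = 0; last by rewrite addr0 oppr0.
  rewrite mxE rel_mxE (negPf (azA _ aA)) add0r.
  rewrite -!mulmxA mulmxA.
  have := rowZ A' (subD1set A a) => /(congr1 (fun M => (M *m (R_ A' *m N)) 0 ia)).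
  by rewrite -row_mul mul0mx !mxE.
have -> : - 'X *: u *m delta_mx 0 (t a) = - (u *m row ia T).
  by rewrite row_target -scalemxAl -scalemxAr scaleNr.
rewrite mulmxDl mul1mx mulNmx -(mulmxA u).
have -> : C (A :\ a) = C A - u *m row ia (R_ A *m T).
  by rewrite -cartan_delete_arrow // opprB addrC subrK.
congr (_ - _); congr (_ *m _).
rewrite -row_mul target_cartan mulmxDl mul1mx.
by rewrite linearD /= (row_mul _ (Z *m X A)) rowZ // mul0mx addr0.
Qed.

(** * Deleting an arrow of a zero cycle *)

(** Here f is the successor map of A under zero relations, and k is the length
of the zero cycle of a. *)
Section ZeroCycle.
Variables (A : {set E}) (a : E) (f : E -> E) (k : nat).
Hypothesis aA : a \in A.
Hypothesis fA : forall c, c \in A -> f c \in A.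
Hypothesis zf : forall c, c \in A -> z c (f c).
Hypothesis z_prev : forall c c' d, z c d -> z c' d -> c = c'.
Hypothesis nz_a : forall c, c \in A -> ~~ nz a c.
Hypothesis target_a : forall c, c \in A -> t c = t a -> c = a.
Hypothesis iter_k : iter k f a = a.
Hypothesis k_gt0 : (0 < k)%N.
Hypothesis k_min : forall j, (0 < j < k)%N -> iter j f a != a.

Local Notation w := (t a).
Let lam : R := 1 - (- 'X) ^+ k.

Let iterA j : iter j f a \in A.
Proof. by elim: j => //= j; apply: fA. Qed.

(** The column identity at f c, whose only predecessor under z is c. *)
Lemma cartan_columnE c i : c \in A -> C A i (t c) =
  (S *m L A) i (enum_rank (f c)) + 'X * (S *m L A) i (enum_rank c).
Proof.
move=> cA; rewrite (z_composable (zf cA)) -mul_sourceE cartan_source.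
rewrite mulmxDr mulmx1 mxE; congr (_ + _); rewrite mulmxA mxE.
rewrite (bigD1 (enum_rank c)) //= big1 => [|d dc].
  by rewrite addr0 mul_restrE enum_rankK cA rel_mxE zf // mulr1n mulrC.
rewrite [Z _ _]mxE enum_rankK; case: (boolP (z _ _)) => [zd|_].
  by move: dc; rewrite -(z_prev zd (zf cA)) enum_valK eqxx.
by rewrite mulr0.
Qed.

(** No nonempty nonzero path can be continued by f a: its last arrow would end
at t a, hence be a itself, but a is followed by f a in a zero relation. *)
Lemma lresolvent_start i : (S *m L A) i (enum_rank (f a)) = (w == i)%:R.
Proof.
rewrite lresolventE mulmxDr mulmx1 mxE -!mulmxA !mulmxA.
rewrite [X in X + _]mxE enum_rankK -(z_composable (zf aA)).
rewrite mxE big1 ?addr0 // => j _; rewrite mul_restrE [N _ _]mxE enum_rankK.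
case: (boolP (_ \in A)) => [jA|_]; last by rewrite mulr0n mul0r.
case: (boolP (nz _ _)) => [/andP[/eqP tj zj]|_]; last by rewrite mulr0.
move: zj; rewrite (target_a jA) ?zf //.
by rewrite tj (z_composable (zf aA)).
Qed.

(** The vertices of the zero cycle, with the signs and powers of q that make the
columns of C(A) telescope; the term j = 0 is the vertex t a. *)
Definition cycle_vector : 'cV[R]_n :=
  \sum_(j < k) (- 'X) ^+ j *: delta_mx (t (iter (k - j) f a)) 0.

Lemma cartan_cycle_vector : C A *m cycle_vector = lam *: delta_mx w 0.
Proof.
apply/colP => i; rewrite mulmx_sumr summxE.
pose h j := (S *m L A) i (enum_rank (iter j f a)).
pose u j := - ((- 'X) ^+ j * h (k - j).+1).
rewrite (eq_bigr (fun j : 'I_k => u j.+1 - u j)) => [|j _]; last first.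
  rewrite -scalemxAr -colE [LHS]mxE [X in _ * X]mxE.
  rewrite cartan_columnE ?iterA // -iterS -/(h _).
  rewrite /u subnSK // exprS -/(h _) mulrDr opprK addrC; congr (_ + _).
  by rewrite !mulNr opprK mulrA [_ * 'X]mulrC.
rewrite -(big_mkord xpredT (fun j => u j.+1 - u j)) telescope_sumr //.
rewrite /u subnn subn0 expr0 mul1r opprK addrC /h iterS iter_k.
rewrite lresolvent_start !mxE eqxx andbT eq_sym -/lam.
by rewrite /lam mulrBl mul1r.
Qed.

(** The cycle passes through t a only once, since a is the only arrow of A that
ends there.  Hence replacing column t a by the telescoping combination is
unimodular. *)
Lemma cycle_vectorE : cycle_vector w 0 = 1.
Proof.
rewrite summxE -(big_mkord xpredT (fun j =>
  ((- 'X : R) ^+ j *: delta_mx (t (iter (k - j) f a)) 0 : 'cV_n) w 0)).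
rewrite big_ltn // !mxE subn0 iter_k !eqxx mulr1.
rewrite big_nat_cond big1 ?addr0 // => j /andP[/andP[j0 jk] _].
rewrite !mxE eqxx andbT; case: eqP => [/esym/target_a wj|_]; last by rewrite mulr0.
have := k_min (j := k - j); rewrite subn_gt0 jk /= ltn_subrL j0 k_gt0.
by rewrite wj ?iterA // eqxx => /(_ isT).
Qed.

(** The column operation turns column t a into 1 - (-q)^k times a unit vector.
Deleting a has the same effect up to that factor: a has no nonzero continuation,
so only paths ending in a are lost, and these all end at t a.  The diagonal
factor d, collected from earlier deletions, is 1 at the vertices where arrows of
A end and therefore commutes with the operation. *)
Lemma cartan_delete_cycle (d : 'rV[R]_n) :
  (forall c, c \in A -> d 0 (t c) = 1) ->
  exists2 P, \det P = 1 & C A *m diag_mx d *m P =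
    C (A :\ a) *m diag_mx (\row_i (if i == w then lam else d 0 i)).
Proof.
move=> dA; pose e : 'cV[R]_n := delta_mx w 0; pose r : 'rV[R]_n := delta_mx 0 w.
pose v := cycle_vector - e; pose A' := A :\ a.
exists (1%:M + v *m r).
  by apply: det_rank_one_update; rewrite !mxE cycle_vectorE !eqxx subrr.
have De c : c \in A -> diag_mx d *m delta_mx (t c) 0 = delta_mx (t c) 0 :> 'cV_n.
  move=> cA; apply/colP => i; rewrite mul_diag_mx !mxE.
  by case: eqP => [->|_]; rewrite ?dA ?mul1r ?mulr0.
have Dv : diag_mx d *m v = v.
  rewrite mulmxBr De //; congr (_ - _); rewrite mulmx_sumr.
  by apply: eq_bigr => j _; rewrite -scalemxAr De ?iterA.
have rD : r *m diag_mx d = r.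
  apply/rowP => i; rewrite mul_mx_diag !mxE eqxx /=.
  by case: eqP => [->|_]; rewrite ?dA ?mulr1 ?mul0r.
pose u := 'X *: (S *m L A' *m col (enum_rank a) 1%:M).
have CE : C A = C A' + u *m r.
  apply/eqP; rewrite addrC -subr_eq cartan_delete_arrow //; apply/eqP.
  rewrite /u -scalemxAl scalemxAr -row_target; congr (_ *m _).
  rewrite rresolventE mulmxDl mul1mx linearD /= -!mulmxA mulmxA row_mul.
  have -> : row (enum_rank a) (N *m X A) = 0; last by rewrite mul0mx addr0.
  apply/rowP => j; rewrite mxE mul_restrE !mxE enum_rankK.
  by case: (boolP (_ \in A)) => [/nz_a/negPf->|_]; rewrite ?mulr0n.
have Ce : C A' *m e = e.
  rewrite cartan_mxE mulmxDl mul1mx -[RHS]addr0; congr (_ + _).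
  rewrite -!mulmxA (_ : X A' *m (T *m e) = 0) ?mulmx0 //.
  apply/colP => j; rewrite restr_mulE -colE !mxE !inE.
  case: (altP (_ =P a)) => [_|ja]; first by rewrite mulr0n.
  case: eqP => [tj|_]; last by rewrite mul0rn.
  case: (boolP (_ \in A)) => [jA|_]; last by rewrite mulr0n.
  by rewrite (target_a jA tj) eqxx in ja.
have -> : diag_mx (\row_i (if i == w then lam else d 0 i)) =
    diag_mx d + (lam - 1) *: (e *m r).
  apply/matrixP => i j; rewrite mul_delta_mx !mxE.
  case: (eqVneq i j) => [->|ij].
    rewrite andbb !mulr1n; case: eqP => [->|_]; rewrite ?mulr0 ?addr0 //.
    by rewrite dA // mulr1 addrC subrK.
  case: (altP (i =P w)) ij => [->|_] ij; last by rewrite !mulr0n mulr0 addr0.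
  by rewrite [j == w]eq_sym (negPf ij) !mulr0n mulr0 addr0.
rewrite mulmxDr mulmx1 -!mulmxA (mulmxA (diag_mx d)) Dv mulmxA mulmxBr.
rewrite cartan_cycle_vector [RHS]mulmxDr -scalemxAr mulmxA Ce.
have re : r *m e = 1%:M.
  by rewrite mul_delta_mx; apply/matrixP => i j; rewrite !ord1 !mxE eqxx.
have CAe : C A *m e = e + u by rewrite CE mulmxDl Ce -mulmxA re mulmx1.
rewrite CAe CE mulmxDl -(mulmxA u) rD -addrA; congr (_ + _).
rewrite opprD addrA mulmxBl addrC subrK.
by move: lam => l; rewrite mulmxBl scalerBl scale1r scalemxAl.
Qed.

End ZeroCycle.

End WeightedMatrices.

(** * Counting zero cycles inside a set of arrows *)

Section CycleClasses.
Local Open Scope nat_scope.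
Variables (Q : quiver) (z : rel (arrow Q)).
Implicit Types (A : {set arrow Q}) (a b c : arrow Q).

Definition cycles_in A k : {set k.-tuple (arrow Q)} :=
  [set p : k.-tuple (arrow Q) | [&& cycle z p, uniq p & all (mem A) p]]%SET.
Definition cycle_classes A k : {set {set k.-tuple (arrow Q)}} :=
  [set rotations p | p in cycles_in A k]%SET.

Lemma rotations_refl k (p : k.-tuple (arrow Q)) :
  (0 < k)%N -> p \in rotations p.
Proof.
move=> k0; rewrite inE; apply/existsP; exists (Ordinal k0); apply/eqP.
by apply: val_inj; rewrite /= rot0.
Qed.

Lemma rotationsP k (p q : k.-tuple (arrow Q)) : (0 < k)%N ->
  reflect (exists i, (q : seq _) = rot i p) (q \in rotations p).
Proof.
move=> k0; apply: (iffP idP) => [|[i qi]].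
  by rewrite inE => /existsP[i /eqP ->]; exists i.
rewrite inE; apply/existsP; have [ik|ki] := ltnP i k.
  by exists (Ordinal ik); apply/eqP/val_inj.
exists (Ordinal k0); apply/eqP/val_inj.
by rewrite /= rot0 qi rot_oversize // size_tuple.
Qed.

Lemma rotations_rot k (p q : k.-tuple (arrow Q)) i : (0 < k)%N ->
  (q : seq _) = rot i p -> rotations q = rotations p.
Proof.
move=> k0 qE; have sub (p' q' : k.-tuple (arrow Q)) j :
    (q' : seq _) = rot j p' -> rotations q' \subset rotations p'.
  move=> q'E; apply/fintype.subsetP => r /(rotationsP _ _ k0)[l rE].
  apply/rotationsP => //; rewrite rE q'E.
  have [jk|/ltnW kj] := leqP j (size p'); last first.
    by exists l; rewrite (rot_oversize kj).
  have [lk|/ltnW kl] := leqP l (size p'); last first.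
    by exists j; rewrite rot_oversize // size_rot.
  exists (if l + j <= size p' then l + j else l + j - size p').
  exact: rot_add_mod.
apply/setP/fintype.subset_eqP; rewrite (sub _ _ i qE) (sub _ _ (size p - i)) //.
have [ik|/ltnW ki] := leqP i (size p).
  by rewrite qE -[LHS](rotK i) /rotr size_rot.
rewrite qE (rot_oversize ki) (_ : size p - i = 0) ?rot0 //.
by apply/eqP; rewrite subn_eq0.
Qed.

Lemma cycle_classes_set0 k : (0 < k)%N ->
  cycle_classes finset.set0 k = finset.set0.
Proof.
move=> k0; rewrite /cycle_classes (_ : cycles_in _ _ = finset.set0) ?imset0 //.
apply/setP => p; rewrite !inE; case: p => -[|c s] //= /eqP sk.
  by rewrite -sk in k0.
by rewrite inE !andbF.
Qed.

(** An arrow on a cycle inside A is followed by the next arrow of the cycle. *)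
Lemma cycle_classes_no_succ A a k : (forall b, b \in A -> ~~ z a b) ->
  cycle_classes A k = cycle_classes (A :\ a) k.
Proof.
move=> az; rewrite /cycle_classes (_ : cycles_in A k = cycles_in (A :\ a) k) //.
apply/setP => p; rewrite !inE; case: (boolP (cycle z p)) => //= zp; congr (_ && _).
apply/allP/allP => [pA x xp|pA x /pA]; last by rewrite !inE => /andP[].
rewrite !inE [x \in A](pA x xp) andbT.
apply: contraTneq (next_cycle zp xp) => xa.
by rewrite {1}xa; apply/az/pA; rewrite mem_next.
Qed.

Section DeleteArrow.
Variables (A : {set arrow Q}) (a : arrow Q) (f : arrow Q -> arrow Q).
Hypothesis aA : a \in A.
Hypothesis fA : forall c, c \in A -> f c \in A.
Hypothesis zf : forall c, c \in A -> z c (f c).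
Hypothesis z_next : forall c d d', z c d -> z c d' -> d = d'.
Hypothesis z_prev : forall c c' d, z c d -> z c' d -> c = c'.

Let f_inj : {in A &, injective f}.
Proof. by move=> c c' cA c'A e; apply: z_prev (zf cA) _; rewrite e zf. Qed.

Lemma iter_order_succ : iter (order f a) f a = a.
Proof. exact: (iter_order_in fA f_inj). Qed.

Lemma iter_lt_order j : (0 < j < order f a)%N -> iter j f a != a.
Proof.
move=> /andP[j0 jk]; apply/eqP => e; have := orbit_uniq f a.
move=> /(nth_uniq a) => /(_ j 0); rewrite size_orbit jk order_gt0 => /(_ isT isT).
rewrite /orbit !nth_traject ?order_gt0 //= e eqxx => /esym/eqP j00.
by rewrite j00 in j0.
Qed.

Let orbit_z : (orbit f a \in [pred p | cycle z p & all (mem A) p]).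
Proof.
have oA : all (mem A) (orbit f a).
  by apply/allP => c /trajectP[i _ ->]; elim: i => //= i; apply: fA.
rewrite inE oA andbT; apply: (sub_in_cycle _ oA) (cycle_orbit_in fA f_inj aA).
by move=> c d cA _ /eqP <-; apply: zf.
Qed.

(** Zero relations being a partial function, every simple cycle through a is a
rotation of the f-orbit of a; so deleting a destroys this one class. *)
Lemma card_cycle_classes_delete k : (0 < k)%N ->
  #|cycle_classes A k| = (#|cycle_classes (A :\ a) k| + (k == order f a))%N.
Proof.
move=> k0; pose B := A :\ a.
have cyc_a (p : k.-tuple _) : p \in cycles_in A k -> a \in p ->
    exists i, orbit f a = rot i p.
  rewrite inE => /and3P[zp up pA] ap.
  have fp : fcycle f p.
    apply: (sub_in_cycle _ pA) zp => c d cA _ zcd; apply/eqP.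
    exact: z_next (zf cA) zcd.
  by have [i] := orbit_rot_cycle fp up ap; exists i.
have BA p : p \in cycles_in B k = (p \in cycles_in A k) && (a \notin (p : seq _)).
  rewrite !inE -!andbA; do 2!congr (_ && _).
  apply/allP/andP => [pB|[/allP pA ap] c cp].
    split; first by apply/allP => c /pB; rewrite !inE => /andP[].
    by apply/negP => /pB; rewrite !inE eqxx.
  by rewrite !inE [c \in A](pA c cp) andbT; apply: contraNneq ap => <-.
case: (altP (k =P order f a)) => [ko|ko]; last first.
  rewrite addn0; congr #|pred_of_set _|; rewrite /cycle_classes.
  rewrite (_ : cycles_in A k = cycles_in B k) //; apply/setP => p; rewrite BA.
  case: (boolP (p \in _)) => //= pA; symmetry; apply: contra ko => ap.
  have [i oE] := cyc_a p pA ap.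
  by rewrite -size_orbit oE size_rot size_tuple.
have so : size (orbit f a) == k by rewrite size_orbit ko.
pose o := Tuple so.
have oA : o \in cycles_in A k.
  by move: orbit_z; rewrite !inE orbit_uniq andTb.
have oN : rotations o \notin cycle_classes B k.
  apply/negP => /imsetP[p]; rewrite BA => /andP[_ /negP ap] oE; apply: ap.
  have := rotations_refl o k0; rewrite oE => /(rotationsP _ _ k0)[i oi].
  by rewrite -(mem_rot i) -oi; exact: in_orbit.
rewrite addn1 -add1n -[1%N]/(nat_of_bool true) -oN -cardsU1.
congr #|pred_of_set _|; apply/setP => r; rewrite !inE.
apply/imsetP/predU1P => [[p pA ->]|[->|/imsetP[p]]]; last 2 first.
- by exists o.
- by rewrite BA => /andP[pA _] ->; exists p.
have [ap|ap] := boolP (a \in (p : seq _)); last first.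
  by right; apply/imsetP; exists p; rewrite ?BA ?pA.
by left; have [i oE] := cyc_a p pA ap; rewrite (rotations_rot (q := o) k0 oE).
Qed.

End DeleteArrow.
End CycleClasses.

(** * Diagonalization by induction on the set of arrows *)

Definition cycle_factor k : {poly int} := 1 - (- 'X) ^+ k.

Lemma size_cycle_factor_tail k : (size ((- 'X : {poly int}) ^+ k)).-1 = k.
Proof. by rewrite size_exp size_polyN size_polyX mul1n. Qed.

Lemma cycle_factor_inj : injective cycle_factor.
Proof.
move=> k l /(congr1 (fun p => 1 - p)); rewrite !subKr => e.
by rewrite -(size_cycle_factor_tail k) e size_cycle_factor_tail.
Qed.

Lemma cycle_factor_neq1 k : cycle_factor k != 1.
Proof.
rewrite -subr_eq0 addrAC subrr add0r oppr_eq0 expf_neq0 //.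
by rewrite oppr_eq0 polyX_eq0.
Qed.

Section Diagonalization.
Variables (Q : quiver) (n : nat) (s t : arrow Q -> 'I_n) (z : rel (arrow Q)).
Variables (rho : arrow Q -> nat) (m : nat).
Local Notation nz := (composable_nonzero s t z).
Hypothesis z_composable : forall a b, z a b -> t a = s b.
Hypothesis rho_decr : forall a b, nz a b -> (rho b < rho a)%N.
Hypothesis rho_bound : forall a, (rho a < m)%N.
Hypothesis z_next : forall c d d', z c d -> z c d' -> d = d'.
Hypothesis z_prev : forall c c' d, z c d -> z c' d -> c = c'.
Local Notation C := (cartan_mx s t z m).

Lemma cartan_mx_set0 : C finset.set0 = 1%:M.
Proof.
rewrite /cartan_mx (_ : restr_mx _ = 0) ?mulmx0 ?mul0mx ?addr0 //.
by apply/matrixP => i j; rewrite !mxE inE mul0rn.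
Qed.

(** The diagonal factor d records the entries already split off.  It has to be 1
at every vertex where an arrow of A ends, as those vertices still take part in
column operations; a vertex that receives an entry is no target afterwards. *)
Lemma cartan_mx_diagonalizable (A : {set arrow Q}) (d : 'rV[{poly int}]_n) :
  (forall c, c \in A -> d 0 (t c) = 1) ->
  exists d' : 'rV[{poly int}]_n,
    [/\ exists P P', [/\ \det P = 1, \det P' = 1 &
          P *m (C A *m diag_mx d) *m P' = diag_mx d'],
        forall k, (0 < k)%N -> #|[set i | d' 0 i == cycle_factor k]%SET| =
          (#|[set i | d 0%R i == cycle_factor k]%SET| + #|cycle_classes z A k|)%N
      & forall i, d' 0 i = d 0 i \/
          exists2 k, (0 < k)%N & d' 0 i = cycle_factor k].
Proof.
have [l] := ubnP #|A|; elim: l A d => // l IH A d Al dA.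
have [A0|[a0 a0A]] := set_0Vmem A.
  exists d; split=> [|k k0|i]; last by left.
    by exists 1%:M, 1%:M; rewrite !det1 A0 cartan_mx_set0 !mul1mx mulmx1.
  by rewrite A0 cycle_classes_set0 // cards0 addn0.
have A'l a : a \in A -> (#|A :\ a| < l)%N.
  by move=> aA; rewrite (cardsD1 a) aA in Al.
case: (pickP [pred a in A | [forall (b | b \in A), ~~ z a b]]) => [a|zA].
  move=> /andP[aA /forall_inP az].
  have d'A c : c \in A :\ a -> d 0 (t c) = 1 by move=> /setD1P[_ /dA].
  have [d' [[P1 [P2 [P1u P2u PE]]] d'k d'E]] := IH _ d (A'l _ aA) d'A.
  have [P Pu PC] := cartan_delete_z_sink z_composable rho_decr rho_bound aA az.
  exists d'; split=> // [|k k0]; last first.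
    by rewrite d'k // [in RHS](cycle_classes_no_succ _ az).
  exists (P1 *m P), P2; split; [by rewrite det_mulmx P1u Pu mul1r | exact: P2u |].
  by rewrite -PE -PC !mulmxA.
have {}zA a : a \in A -> exists2 b, b \in A & z a b.
  move=> aA; have := zA a; rewrite inE aA => /negbT.
  by rewrite negb_forall_in => /exists_inP[b bA]; rewrite negbK; exists b.
pose f c := odflt c [pick b in A | z c b].
have fP c : c \in A -> f c \in A /\ z c (f c).
  move=> /zA[b bA zcb]; rewrite /f; case: pickP => [b' /andP[]//|/(_ b)].
  by rewrite /= bA zcb.
have fA c : c \in A -> f c \in A by move=> /fP[].
have zf c : c \in A -> z c (f c) by move=> /fP[].
(* Every arrow of A now lies on a zero cycle; one of minimal rank has no nonzero
   continuation in A. *)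
case: (arg_minnP rho a0A) => a aA amin.
have nza c : c \in A -> ~~ nz a c.
  by move=> cA; apply/negP => /rho_decr; rewrite ltnNge amin.
have target_a c : c \in A -> t c = t a -> c = a.
  move=> cA tc; have := nza _ (fA _ cA); rewrite /composable_nonzero.
  rewrite -tc (z_composable (zf _ cA)) eqxx negbK => zac.
  exact: z_prev (zf _ cA) zac.
have ord0 := order_gt0 f a.
have [P Pu PE] := cartan_delete_cycle z_composable rho_decr rho_bound aA fA zf
  z_prev nza target_a (iter_order_succ aA fA zf z_prev) ord0
  (@iter_lt_order _ a f) dA.
set d1 := (\row_i _) in PE.
have d1A c : c \in A :\ a -> d1 0 (t c) = 1.
  move=> /setD1P[ca cA]; rewrite mxE; case: eqP => [/target_a -/(_ cA) e|_].
    by rewrite e eqxx in ca.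
  exact: dA.
have [d' [[P1 [P2 [P1u P2u P12E]]] d'k d'E]] := IH _ d1 (A'l _ aA) d1A.
exists d'; split=> [|k k0|i].
- exists P1, (P *m P2); split; [exact: P1u | by rewrite det_mulmx Pu P2u mulr1 |].
  by rewrite -P12E -PE !mulmxA.
- rewrite d'k // (card_cycle_classes_delete aA fA zf z_next z_prev k0).
  rewrite addnA addnAC; congr (_ + _)%N.
  rewrite (cardsD1 (t a)) inE mxE eqxx (inj_eq cycle_factor_inj) addnC eq_sym.
  congr (_ + _)%N; apply: eq_card => i; rewrite !inE mxE.
  case: eqP => [->|//]; rewrite dA //=.
  by rewrite eq_sym (negPf (cycle_factor_neq1 k)).
- case: (d'E i) => [->|]; last by right.
  rewrite mxE; case: eqP => _; last by left.
  by right; exists (order f a).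
Qed.

End Diagonalization.

(** * The q-Cartan matrix counts nonzero paths *)

Lemma card_tuple_cons (T : finType) k (P : pred (seq T)) :
  #|[set u : k.+1.-tuple T | P u]%SET| =
  (\sum_(c : T) #|[set u : k.-tuple T | P (c :: u)]%SET|)%N.
Proof.
rewrite -sum1dep_card; under [RHS]eq_bigr => c _ do rewrite -sum1dep_card.
rewrite pair_big_dep /=.
rewrite (reindex (fun p : T * k.-tuple T => cons_tuple p.1 p.2)) //=.
exists (fun u : k.+1.-tuple T => (thead u, [tuple of behead u])) => [[c u] _|u _].
  by congr (_, _); apply: val_inj.
by rewrite [RHS]tuple_eta; apply: val_inj.
Qed.

Section PathCounting.
Variables (E : finType) (n : nat) (s t : E -> 'I_n) (z : rel E) (m : nat).
Local Notation r := (composable_nonzero s t z).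

Lemma sum_enum_rank (V : nmodType) (F : 'I_#|E| -> V) :
  \sum_i F i = \sum_(a : E) F (enum_rank a).
Proof. by rewrite (reindex _ (onW_bij _ (@enum_rank_bij E))). Qed.

Lemma rel_mx_exp_targetE k a j :
  (rel_mx r ^+ k *m target_mx t) (enum_rank a) j =
  'X^(k.+1) *+ #|[set u : k.-tuple E | path r a u && (t (last a u) == j)]%SET|.
Proof.
elim: k a => [|k IH] a.
  rewrite expr0 mul1mx mxE enum_rankK expr1.
  case: eqP => tj; congr (_ *+ _); apply/esym.
    rewrite -[RHS](card_tuple 0 E) -cardsT; apply: eq_card => u.
    by rewrite !inE tuple0 /= tj eqxx.
  by apply: eq_card0 => u; rewrite !inE tuple0 /=; apply/eqP.
rewrite (card_tuple_cons k (fun u => path r a u && (t (last a u) == j))).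
rewrite exprS -mulmxA mxE sum_enum_rank -[RHS]sumrMnr; apply: eq_bigr => c _.
rewrite IH rel_mxE /=; case: (boolP (r a c)) => rac /=.
  by rewrite mulr1n mulrnAr -exprS.
by rewrite mulr0n mul0r eq_card0 // => u; rewrite !inE.
Qed.

(** A list of arrows determines a path unless it is empty, where the two
endpoints are compared instead. *)
Definition connecting_walk i j (u : seq E) :=
  if u is a :: u' then [&& s a == i, path r a u' & t (last a u') == j]
  else i == j.

Lemma cartan_mxTE i j : cartan_mx s t z m [set: E]%SET i j =
  \sum_(k < m.+1) 'X^k *+ #|[set u : k.-tuple E | connecting_walk i j u]%SET|.
Proof.
have X1 : restr_mx [set: E]%SET = 1%:M.
  by apply/matrixP => k l; rewrite !mxE inE.
rewrite /cartan_mx /rresolvent !X1 !mulmx1 -mulmxA mxE big_ord_recl /=.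
congr (_ + _).
  rewrite mxE expr0 (_ : #|_| = (i == j)) //.
  case: (altP (i =P j)) => ij; last first.
    by apply: eq_card0 => u; rewrite !inE tuple0 /=; apply: negPf.
  rewrite -[RHS](card_tuple 0 E) -cardsT; apply: eq_card => u.
  by rewrite !inE tuple0 /= ij eqxx.
rewrite mulmx_suml mulmx_sumr summxE; apply: eq_bigr => k _.
rewrite mxE sum_enum_rank (card_tuple_cons k (connecting_walk i j)) -sumrMnr.
apply: eq_bigr => a _; rewrite rel_mx_exp_targetE mxE enum_rankK.
rewrite /connecting_walk; case: eqP => _; first by rewrite mul1r.
by rewrite mul0r eq_card0 // => u; rewrite !inE.
Qed.

End PathCounting.

(** Take for rho a the maximal length of a path behind a. *)
Lemma path_rank_exists (E : finType) (r : rel E) m :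
  (forall a u, path r a u -> (size u < m)%N) ->
  exists rho : E -> nat, (forall a b, r a b -> (rho b < rho a)%N) /\
    (forall a, (rho a < m)%N).
Proof.
move=> bound.
have H a : exists k, (exists2 u, path r a u & size u = k) /\
    forall u, path r a u -> (size u <= k)%N.
  pose P k := [exists u : k.-tuple E, path r a u].
  have P0 : exists k, P k by exists 0%N; apply/existsP; exists [tuple].
  have Pm k : P k -> (k <= m)%N.
    by move=> /existsP[u /bound]; rewrite size_tuple; apply: ltnW.
  case: (ex_maxnP P0 Pm) => k /existsP[u ru] kmax; exists k; split.
    by exists u; rewrite ?size_tuple.
  by move=> v rv; apply/kmax/existsP; exists (in_tuple v).
have [rho rhoP] := fin_all_exists H; exists rho; split=> [a b rab|a].
  have [[u ru <-] _] := rhoP b; have [_ amax] := rhoP a.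
  by apply: (amax (b :: u)); rewrite /= rab.
by have [[u ru <-] _] := rhoP a; apply: bound ru.
Qed.

Section CartanMatrix.
Variables (K : fieldType) (Q : quiver) (I : twoSidedIdeal (pathalg K Q)).

Definition source_rank (a : arrow Q) : 'I_#|vertex Q| := enum_rank (source a).
Definition target_rank (a : arrow Q) : 'I_#|vertex Q| := enum_rank (target a).

Lemma composable_nonzeroE :
  composable_nonzero source_rank target_rank (zero_rel I) =2 nonzero_rel I.
Proof.
move=> a b; rewrite /composable_nonzero /zero_rel /nonzero_rel.
by rewrite (inj_eq enum_rank_inj); case: eqP.
Qed.

Lemma nonzero_rel_walk a u : path (nonzero_rel I) a u -> walk (target a) u.
Proof.
by elim: u a => //= b u IH a /andP[/andP[/eqP-> _] /IH->]; rewrite eqxx.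
Qed.

Lemma connecting_walkE v w k : [set u : k.-tuple (arrow Q) |
    connecting_walk source_rank target_rank (zero_rel I)
      (enum_rank v) (enum_rank w) u]%SET = nonzero_walks I k v w.
Proof.
apply/setP => u; rewrite !inE; case: u => -[|a u] _ /=.
  by rewrite (inj_eq enum_rank_inj).
rewrite !(inj_eq enum_rank_inj) (eq_path composable_nonzeroE) -andbA last_map.
congr (_ && _); case: (boolP (path _ a u)) => [ru|]; last by rewrite andbF.
by rewrite (nonzero_rel_walk ru).
Qed.

Lemma nonzero_rel_path_bounded m :
  (forall p, nonzero_path I p -> (path_length p < m)%N) ->
  forall a u, path (nonzero_rel I) a u -> (size u < m)%N.
Proof.
move=> bound a u ru.
have w : walk (source a) (a :: u).
  by rewrite /= eqxx (nonzero_rel_walk ru).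
apply: ltn_trans (ltnSn _) (bound (exist _ (source a, a :: u) w) ru).
Qed.

Lemma qCartanE m (S : set (qpath Q)) :
  (forall p, S p -> path_length p = 2) ->
  (forall x, x \in I <-> ideal_span [set path_elt K p | p in S]%classic x) ->
  (forall p, nonzero_path I p -> (path_length p < m)%N) ->
  qCartan I =
    cartan_mx source_rank target_rank (zero_rel I) m [set: arrow Q]%SET.
Proof.
move=> S2 SI bound; apply/matrixP => i j; rewrite mxE cartan_mxTE /qCartan_entry.
rewrite -(fsbig_widen `I_m.+1); first last.
- move=> k /= [_ /negP km]; rewrite (dim_peirce_piece S2 SI).
  rewrite [X in _ *+ X](_ : _ = 0%N) ?mulr0n //; apply/eqP; rewrite cards_eq0.
  apply/eqP/setP => u; rewrite !inE; apply/negP => /and3P[wu su _].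
  have := bound (exist _ (enum_val i, tval u) wu) su.
  rewrite /path_length /path_arrows /= size_tuple => /leqW km'.
  by rewrite km' in km.
- by [].
rewrite -fsbig_ord; apply: eq_bigr => k _.
rewrite (dim_peirce_piece S2 SI) -connecting_walkE.
by rewrite !enum_valK.
Qed.

End CartanMatrix.

(** * The theorem *)

Theorem theorem1 (K : fieldType) (Q : quiver)
    (I : twoSidedIdeal (pathalg K Q)) :
  gentle I -> finite_dim (quotalg I) ->
  exists d : 'rV[{poly int}]_#|vertex Q|,
    [/\ unimodularly_equivalent (qCartan I) (diag_mx d),
        forall k : nat, (0 < k)%N ->
          #|[set i | d 0 i == 1 - (- 'X) ^+ k]%SET| = num_zero_cycles I k
      & forall i, d 0 i = 1 \/ exists2 k : nat, (0 < k)%N & d 0 i = 1 - (- 'X) ^+ k].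
Proof.
move=> gI fdI; have [S S2 SI] := gentle_gen gI.
have [m bound] := nonzero_path_bounded S2 SI fdI.
have [rho [rho_decr rho_lt]] :=
  path_rank_exists (nonzero_rel_path_bounded bound).
have decr a b : composable_nonzero (@source_rank Q) (@target_rank Q)
    (zero_rel I) a b -> (rho b < rho a)%N.
  by rewrite composable_nonzeroE; apply: rho_decr.
have z_composable a b : zero_rel I a b -> target_rank a = source_rank b.
  by move=> /andP[/eqP ab _]; rewrite /target_rank ab.
have z_next c d d' : zero_rel I c d -> zero_rel I c d' -> d = d'.
  by move=> /andP[/eqP ? ?] /andP[/eqP ? ?]; apply: (gentle_next0 gI (a := c)).
have z_prev c c' d : zero_rel I c d -> zero_rel I c' d -> c = c'.
  by move=> /andP[/eqP ? ?] /andP[/eqP ? ?]; apply: (gentle_prev0 gI (a := d)).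
have [|d [[P [P' [P1 P'1 PE]]] dk dE]] :=
  cartan_mx_diagonalizable z_composable decr rho_lt z_next z_prev
    (A := [set: arrow Q]%SET) (d := const_mx 1).
  by move=> c _; rewrite mxE.
exists d; split=> [|k k0|i].
- exists P, P'; split=> //; rewrite -PE (qCartanE S2 SI bound).
  by rewrite diag_const_mx mulmx1.
- rewrite dk // (_ : #|_| = 0%N) ?add0n; last first.
    apply: eq_card0 => i; rewrite !inE mxE eq_sym.
    exact: negPf (cycle_factor_neq1 k).
  have memT p : (p \in cycles_in (zero_rel I) [set: arrow Q]%SET k) =
      min_zero_cycle I p.
    rewrite inE /min_zero_cycle (_ : all _ _ = true) ?andbT //.
    by apply/allP => c _; rewrite inE.
  apply: eq_card => C; apply/imsetP/imsetP => -[p pz ->]; exists p => //.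
    by rewrite inE -memT.
  by rewrite memT; move: pz; rewrite inE.
- by case: (dE i) => [->|]; [left; rewrite mxE | right].
Qed.
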